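(* Let $A$ and $S$ be finite sets and let $f: A\to A$ be a map. Then $f$ is a bijection if and only if for any surjection $\psi: A\to S$, $\varphi=\psi\circ f$ is a surjection and $f$ is injective on $\varphi^{-1}(s)$ for each $s\in S$.
   Context: Here $\varphi=\psi\circ f$ is the map $A\to S$ given by $\varphi(a)=\psi(f(a))$, and for $s\in S$, $\varphi^{-1}(s)=\{a\in A:\varphi(a)=s\}$ denotes the fibre of $\varphi$ over $s$.
   Formalization: The formal statement assumes that at least one surjection from A to S exists; without it (e.g. A with two elements, S with three, f constant) the right-hand condition holds vacuously and the claim is false. *)

(* Defs.v *)
From mathcomp Require Import all_boot.

Set Implicit Arguments.
Unset Strict Implicit.
Unset Printing Implicit Defensive.

Definition surjective (T U : Type) (h : T -> U) : Prop :=
  forall u : U, exists t : T, h t = u.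

(* Main.v *)
Require Import Defs.
From mathcomp Require Import all_boot.

(** If [f x = f y], then [psi (f x) = psi (f y)] for every [psi], so [x] and [y]
    already lie in one fibre of [psi \o f]. Injectivity of [f] on all the fibres
    for a single [psi] therefore gives injectivity of [f], and an injective
    self-map of a finite set is bijective. Conversely, a bijective [f] is
    injective on every subset, and composing it with a surjection gives a
    surjection. *)

(* [hS] makes explicit that "any surjection A -> S" is not vacuous: without a
   surjection (e.g. S empty, A = bool) every f would satisfy the right side. *)
Theorem lemma2p1 (A S : finType) (f : A -> A)
    (hS : exists psi : A -> S, surjective psi) :
  bijective f <->
  (forall psi : A -> S, surjective psi ->
     surjective (psi \o f) /\
     forall s : S, {in (psi \o f) @^-1: [set s] &, injective f}).
Proof.
split=> [bij_f psi surj_psi | fibres_f].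
  split=> [s | s x y _ _]; last exact: (bij_inj bij_f).
  have [a <-] := surj_psi s; have [g _ gK] := bij_f.
  by exists (g a); rewrite /= gK.
have [psi /fibres_f [_ inj_f]] := hS.
apply: injF_bij => x y eq_fxy.
by apply: (inj_f (psi (f x))); rewrite // !inE //= eq_fxy.
Qed.
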